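(* Let $F=f+\Psi$ on $\mathbb{R}^N$, where $f$ is twice continuously differentiable and strongly convex with parameter $\mu_f>0$, and for every block $i$ there is $M_i>0$ with $\|\nabla_i^2f(x+U_it^{(i)})-\nabla_i^2f(x)\|\le M_i\|t^{(i)}\|$ for all $x\in\mathbb{R}^N$, $t^{(i)}\in\mathbb{R}^{N_i}$. Let $x_k$ and the block $i$ be generated by RCD with $H_k^{(i)}=\nabla_i^2f(x_k)$, $\theta\in(0,1/2)$ and $\xi\in(\theta,1/2)$, where the subproblem of minimizing $Q_i(x_k;\cdot)$ is solved inexactly until $$\xi\big(\ell(x_k;0)-\ell(x_k;U_it_k^{(i)})\big)\le Q(x_k;0)-Q(x_k;U_it_k^{(i)})\quad\text{and}\quad\|g_i(x_k;t_k^{(i)})\|\le\eta_k^i\|g_i(x_k;0)\|,$$ with $\eta_k^i\in[0,1)$. Let $\lambda_i=\lambda_{\min}(H_k^{(i)})\ge\mu_f>0$. If $$\|t_k^{(i)}\|\le\frac{3\lambda_i(\xi-\theta)}{M_i},$$ then the backtracking line search step of RCD accepts the step size $\alpha=1$.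
   Context: Problem: minimize $F(x)=f(x)+\Psi(x)$ over $x\in\mathbb{R}^N$, with $\Psi:\mathbb{R}^N\to\mathbb{R}\cup\{+\infty\}$ convex (proper and lower semicontinuous, so that the proximal mappings below are well defined) and block separable. $\|\cdot\|$ is the Euclidean norm (spectral norm for matrices), $\|v\|_A=\sqrt{\langle v,Av\rangle}$ for positive definite $A$, $\lambda_{\min}$ is the smallest eigenvalue. Strong convexity with parameter $\mu_f$: $f(y)\ge f(x)+\langle\nabla f(x),y-x\rangle+\frac{\mu_f}{2}\|y-x\|^2$. Blocks: there is a finite family of blocks $i$, each a nonempty subset of $\{1,\dots,N\}$ of size $N_i$, whose union is $\{1,\dots,N\}$. $U_i\in\mathbb{R}^{N\times N_i}$ consists of the columns of the identity indexed by $i$; $x^{(i)}=U_i^Tx$, $\nabla_if(x)=U_i^T\nabla f(x)$, $\nabla_i^2f(x)=U_i^T\nabla^2f(x)U_i$. The blocks respect the structure of $\Psi$: for each block $i$, $\Psi(x)$ is the sum of a convex function $\Psi_i(x^{(i)})$ and a convex function of the remaining coordinates. Proximal maps: $\Phi^*$ denotes the convex conjugate, $\mathrm{prox}_\Phi(x)=\arg\min_y\{\Phi(y)+\frac12\|y-x\|^2\}$, and $(\beta\Psi)_i^*$ denotes the conjugate of $\beta\Psi_i$. For a fixed $\beta>0$, $$g_i(x;t^{(i)})=\nabla_if(x)+H^{(i)}(x)t^{(i)}+\tfrac1\beta\,\mathrm{prox}_{(\beta\Psi)_i^*}\big(x^{(i)}+t^{(i)}-\beta(\nabla_if(x)+H^{(i)}(x)t^{(i)})\big),$$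 with $H^{(i)}(x)=\nabla_i^2f(x)$ here; $H_k^{(i)}=H^{(i)}(x_k)$. Model and loss: $Q_i(x;t^{(i)})=\langle\nabla_if(x),t^{(i)}\rangle+\frac12\|t^{(i)}\|^2_{H^{(i)}(x)}+\Psi_i(x^{(i)}+t^{(i)})$; $Q(x;U_it^{(i)})=f(x)+\langle\nabla_if(x),t^{(i)}\rangle+\frac12\|t^{(i)}\|^2_{H^{(i)}(x)}+\Psi(x+U_it^{(i)})$, so $Q(x;0)=F(x)$; $\ell(x;t)=f(x)+\langle\nabla f(x),t\rangle+\Psi(x+t)$. Algorithm RCD: choose $x_0$ with $F(x_0)<\infty$, $\theta\in(0,1/2)$, $\beta>0$, and sampling probabilities $p_i>0$. At iteration $k$: sample a block $i$ with probability $p_i$. If $g_i(x_k;0)=0$, go to the next iteration with $x_{k+1}=x_k$. Otherwise approximately minimize $Q_i(x_k;\cdot)$ to obtain $t_k^{(i)}$ satisfying the stopping conditions given in the claim. Then backtrack from $\alpha=1$ until $$F(x_k)-F(x_k+\alpha U_it_k^{(i)})\ge\theta\,\big(\ell(x_k;0)-\ell(x_k;\alpha U_it_k^{(i)})\big),$$ and set $x_{k+1}=x_k+\alpha U_it_k^{(i)}$. ''Accepts $\alpha=1$'' means that this inequality holds with $\alpha=1$. *)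

(* Defs.v *)
(* Vectors are column vectors; the library's
   norm on matrices is the sup norm, so the Euclidean and spectral norms are
   defined here (the topology, hence differentiability, is the same). *)
From HB Require Import structures.
From mathcomp Require Import all_boot all_order all_algebra.
From mathcomp Require Import all_classical all_reals all_analysis.

Set Implicit Arguments.
Unset Strict Implicit.
Unset Printing Implicit Defensive.

Import Order.TTheory GRing.Theory Num.Theory.
Import numFieldNormedType.Exports.

Local Open Scope classical_set_scope.
Local Open Scope ring_scope.

Definition dotp (R : realType) (n : nat) (u v : 'cV[R]_n) : R :=
  \sum_(j < n) u j 0 * v j 0.

Definition enorm (R : realType) (n : nat) (u : 'cV[R]_n) : R :=
  Num.sqrt (dotp u u).

Definition anorm (R : realType) (n : nat) (A : 'M[R]_n) (u : 'cV[R]_n) : R :=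
  Num.sqrt (dotp u (A *m u)).

Definition spectral_norm (R : realType) (m n : nat) (A : 'M[R]_(m, n)) : R :=
  sup [set enorm (A *m v) | v in [set v : 'cV[R]_n | enorm v <= 1]].

(* Only used at symmetric matrices of positive size, which have a real
   eigenvalue; the set of eigenvalues is finite, so the infimum is a minimum. *)
Definition lambda_min (R : realType) (n : nat) (A : 'M[R]_n) : R :=
  inf [set a : R | eigenvalue A a].

Definition gradient (R : realType) (n : nat) (f : 'cV[R]_n -> R)
    (x : 'cV[R]_n) : 'cV[R]_n :=
  \col_j 'D_(delta_mx j 0 : 'cV[R]_n) f x.

Definition hessian (R : realType) (n : nat) (f : 'cV[R]_n -> R)
    (x : 'cV[R]_n) : 'M[R]_n :=
  \matrix_(j, k) 'D_(delta_mx j 0 : 'cV[R]_n)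
                   (fun y => 'D_(delta_mx k 0 : 'cV[R]_n) f y) x.

Definition twice_continuously_differentiable (R : realType) (n : nat)
    (f : 'cV[R]_n -> R) : Prop :=
  [/\ forall x, differentiable f x,
      forall x, differentiable (gradient f) x
    & continuous (hessian f)].

Definition strongly_convex (R : realType) (n : nat) (f : 'cV[R]_n -> R)
    (mu : R) : Prop :=
  forall x y, f x + dotp (gradient f x) (y - x) + mu / 2 * enorm (y - x) ^+ 2
              <= f y.

Definition proper_efun (R : realType) (n : nat) (phi : 'cV[R]_n -> \bar R) : Prop :=
  (forall x, phi x != -oo%E) /\ exists x, (phi x < +oo)%E.

Definition econvex (R : realType) (n : nat) (phi : 'cV[R]_n -> \bar R) : Prop :=
  forall (x y : 'cV[R]_n) (a : R), 0 < a < 1 ->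
    (phi (a *: x + (1 - a) *: y)%R
       <= a%:E * phi x + (1 - a)%:E * phi y)%E.

Definition econjugate (R : realType) (n : nat) (phi : 'cV[R]_n -> \bar R)
    (u : 'cV[R]_n) : \bar R :=
  ereal_sup (range (fun v => (dotp u v)%:E - phi v)%E).

Definition argmin (R : realType) (n : nat) (h : 'cV[R]_n -> \bar R)
    : set 'cV[R]_n :=
  [set y | forall z, (h y <= h z)%E].

(* [get] selects an element of the set of minimizers, which is a singleton
   when [phi] is proper, convex and lower semicontinuous. *)
Definition prox (R : realType) (n : nat) (phi : 'cV[R]_n -> \bar R)
    (x : 'cV[R]_n) : 'cV[R]_n :=
  get (argmin (fun y => phi y + (2^-1 * enorm (y - x) ^+ 2)%:E)%E).

(* A block is a set [S] of coordinates; R^(N_i) is ['cV[R]_#|S|], the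
   coordinates of [S] being listed by [enum_val]. *)
Definition blockU (R : realType) (N : nat) (S : {set 'I_N})
    : 'M[R]_(N, #|S|) :=
  colsub (fun c : 'I_#|S| => enum_val c) 1%:M.
Arguments blockU {R N} S.

Definition block_gradient (R : realType) (N : nat) (f : 'cV[R]_N -> R)
    (S : {set 'I_N}) (x : 'cV[R]_N) : 'cV[R]_#|S| :=
  (blockU S)^T *m gradient f x.

Definition block_hessian (R : realType) (N : nat) (f : 'cV[R]_N -> R)
    (S : {set 'I_N}) (x : 'cV[R]_N) : 'M[R]_#|S| :=
  (blockU S)^T *m hessian f x *m blockU S.

Definition block_separable (R : realType) (N : nat) (Psi : 'cV[R]_N -> \bar R)
    (S : {set 'I_N}) (psi : 'cV[R]_#|S| -> \bar R) : Prop :=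
  econvex psi /\
  exists2 rest : 'cV[R]_#|~: S| -> \bar R, econvex rest &
    forall x, Psi x = (psi ((blockU S)^T *m x)
                       + rest ((blockU (~: S))^T *m x))%E.

Definition objective (R : realType) (N : nat) (f : 'cV[R]_N -> R)
    (Psi : 'cV[R]_N -> \bar R) (x : 'cV[R]_N) : \bar R :=
  ((f x)%:E + Psi x)%E.

Definition loss (R : realType) (N : nat) (f : 'cV[R]_N -> R)
    (Psi : 'cV[R]_N -> \bar R) (x t : 'cV[R]_N) : \bar R :=
  ((f x + dotp (gradient f x) t)%:E + Psi (x + t)%R)%E.

(* [model f Psi S x t] is Q(x; U t) for the block [S]. *)
Definition model (R : realType) (N : nat) (f : 'cV[R]_N -> R)
    (Psi : 'cV[R]_N -> \bar R) (S : {set 'I_N}) (x : 'cV[R]_N)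
    (t : 'cV[R]_#|S|) : \bar R :=
  ((f x + dotp (block_gradient f S x) t
      + 2^-1 * anorm (block_hessian f S x) t ^+ 2)%:E
   + Psi (x + blockU S *m t)%R)%E.

(* The stationarity residual g_i(x; t), where [psi] is the block function. *)
Definition residual (R : realType) (N : nat) (f : 'cV[R]_N -> R)
    (S : {set 'I_N}) (psi : 'cV[R]_#|S| -> \bar R) (beta : R)
    (x : 'cV[R]_N) (t : 'cV[R]_#|S|) : 'cV[R]_#|S| :=
  let d := block_gradient f S x + block_hessian f S x *m t in
  d + beta^-1 *: prox (econjugate (fun u => beta%:E * psi u)%E)
                   ((blockU S)^T *m x + t - beta *: d).

(* In [stopping] and [accepts] the compared decreases are differences of finite
   values: since [a - +oo = -oo], without the first clause the inequality would
   read [-oo <= -oo] at a trial point outside the domain of [Psi]. *)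
Definition stopping (R : realType) (N : nat) (f : 'cV[R]_N -> R)
    (Psi : 'cV[R]_N -> \bar R) (S : {set 'I_N}) (psi : 'cV[R]_#|S| -> \bar R)
    (beta xi eta : R) (x : 'cV[R]_N) (t : 'cV[R]_#|S|) : Prop :=
  [/\ (model f Psi x t < +oo)%E,
      (xi%:E * (loss f Psi x 0%R - loss f Psi x (blockU S *m t)%R)
         <= model f Psi x (0%R : 'cV[R]_#|S|) - model f Psi x t)%E
    & enorm (residual f psi beta x t) <= eta * enorm (residual f psi beta x 0)].

Definition accepts (R : realType) (N : nat) (f : 'cV[R]_N -> R)
    (Psi : 'cV[R]_N -> \bar R) (theta : R) (x d : 'cV[R]_N) (a : R) : Prop :=
  (objective f Psi (x + a *: d)%R < +oo)%E /\
  (theta%:E * (loss f Psi x 0%R - loss f Psi x (a *: d)%R)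
     <= objective f Psi x - objective f Psi (x + a *: d)%R)%E.

(* The trial steps start at 1 and strictly decrease; the rule generating them
   is left arbitrary.  [a] is the first accepted one. *)
Definition backtracking (R : realType) (N : nat) (f : 'cV[R]_N -> R)
    (Psi : 'cV[R]_N -> \bar R) (theta : R) (x d : 'cV[R]_N) (a : R) : Prop :=
  exists (trial : nat -> R) (j : nat),
    [/\ trial 0%N = 1,
        forall m, 0 < trial m.+1 < trial m,
        a = trial j,
        accepts f Psi theta x d (trial j)
      & forall m, (m < j)%N -> ~ accepts f Psi theta x d (trial m)].

(* [RCD_iterate ... k x]: for some realization of the sampled blocks and some
   inexact subproblem solutions, [x] is the k-th iterate. *)
Inductive RCD_iterate (R : realType) (N : nat) (I : finType)
    (f : 'cV[R]_N -> R) (Psi : 'cV[R]_N -> \bar R) (B : I -> {set 'I_N})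
    (psi : forall i : I, 'cV[R]_#|B i| -> \bar R) (p : I -> R)
    (beta theta xi : R) (eta : nat -> I -> R) : nat -> 'cV[R]_N -> Prop :=
| RCD_start (x0 : 'cV[R]_N) :
    (objective f Psi x0 < +oo)%E ->
    RCD_iterate f Psi psi p beta theta xi eta 0 x0
| RCD_skip (k : nat) (x : 'cV[R]_N) (i : I) :
    RCD_iterate f Psi psi p beta theta xi eta k x ->
    0 < p i ->
    residual f (psi i) beta x 0 = 0 ->
    RCD_iterate f Psi psi p beta theta xi eta k.+1 x
| RCD_move (k : nat) (x : 'cV[R]_N) (i : I) (t : 'cV[R]_#|B i|) (a : R) :
    RCD_iterate f Psi psi p beta theta xi eta k x ->
    0 < p i ->
    residual f (psi i) beta x 0 <> 0 ->
    stopping f Psi (psi i) beta xi (eta k i) x t ->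
    backtracking f Psi theta x (blockU (B i) *m t) a ->
    RCD_iterate f Psi psi p beta theta xi eta k.+1
      (x + a *: (blockU (B i) *m t)).

(* Main.v *)
(* The Lipschitz bound on the block Hessian gives, by second-order Taylor
   expansion along [U_i t], f(x + U_i t) <= f(x) + <g, t> + <t, H t> / 2
   + M |t|^3 / 6.  So the true decrease is at least the model decrease minus
   M |t|^3 / 6.  The stopping condition bounds the model decrease below by
   [xi] times the decrease D of the linearized loss, and also forces
   D >= <t, H t> / 2 >= lambda_min(H) |t|^2 / 2, so the surplus (xi - theta) D
   absorbs the cubic error exactly when |t| <= 3 lambda_min(H) (xi - theta) / M.
   The Rayleigh bound <t, H t> >= lambda_min(H) |t|^2 needs H symmetric, which
   is Clairaut's theorem. *)
Require Import Defs.
From HB Require Import structures.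
From mathcomp Require Import all_boot all_order all_algebra.
From mathcomp Require Import all_classical all_reals all_analysis.
From mathcomp Require Import ring lra.

Set Implicit Arguments.
Unset Strict Implicit.

Import Order.TTheory GRing.Theory Num.Theory.
Import numFieldNormedType.Exports.

Local Open Scope classical_set_scope.
Local Open Scope ring_scope.

(** * Euclidean inner product and norm *)

Lemma dotpE (R : realType) (n : nat) (u v : 'cV[R]_n) :
  dotp u v = (u^T *m v) 0 0.
Proof. by rewrite mxE; apply: eq_bigr => j _; rewrite mxE. Qed.

Lemma dotpC (R : realType) (n : nat) (u v : 'cV[R]_n) : dotp u v = dotp v u.
Proof. by apply: eq_bigr => j _; rewrite mulrC. Qed.

Lemma dotpDr (R : realType) (n : nat) (u v w : 'cV[R]_n) :
  dotp u (v + w) = dotp u v + dotp u w.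
Proof. by rewrite !dotpE mulmxDr mxE. Qed.

Lemma dotpDl (R : realType) (n : nat) (u v w : 'cV[R]_n) :
  dotp (u + v) w = dotp u w + dotp v w.
Proof. by rewrite ![dotp _ w]dotpC dotpDr. Qed.

Lemma dotpZr (R : realType) (n : nat) (a : R) (u v : 'cV[R]_n) :
  dotp u (a *: v) = a * dotp u v.
Proof. by rewrite !dotpE -scalemxAr mxE. Qed.

Lemma dotpZl (R : realType) (n : nat) (a : R) (u v : 'cV[R]_n) :
  dotp (a *: u) v = a * dotp u v.
Proof. by rewrite dotpC dotpZr dotpC. Qed.

Lemma dotp0 (R : realType) (n : nat) (u : 'cV[R]_n) : dotp u 0 = 0.
Proof. by rewrite dotpE mulmx0 mxE. Qed.

Lemma dotp_mulmxl (R : realType) (m n : nat) (A : 'M[R]_(m, n))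
    (u : 'cV[R]_n) (v : 'cV[R]_m) :
  dotp (A *m u) v = dotp u (A^T *m v).
Proof. by rewrite !dotpE trmx_mul mulmxA. Qed.

Lemma dotp_ge0 (R : realType) (n : nat) (u : 'cV[R]_n) : 0 <= dotp u u.
Proof. by apply: sumr_ge0 => j _; rewrite -expr2 sqr_ge0. Qed.

Lemma dotp_eq0 (R : realType) (n : nat) (u : 'cV[R]_n) :
  (dotp u u == 0) = (u == 0).
Proof.
apply/idP/eqP => [|->]; last by rewrite dotp0.
rewrite psumr_eq0 => [/allP u0|j _]; last by rewrite -expr2 sqr_ge0.
apply/matrixP => j l; rewrite ord1 mxE.
by apply/eqP; have := u0 j (mem_index_enum j); rewrite mulf_eq0 orbb.
Qed.

Lemma dotp_gt0 (R : realType) (n : nat) (u : 'cV[R]_n) :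
  u != 0 -> 0 < dotp u u.
Proof. by move=> u0; rewrite lt_neqAle eq_sym dotp_eq0 u0 dotp_ge0. Qed.

Lemma enorm_ge0 (R : realType) (n : nat) (u : 'cV[R]_n) : 0 <= enorm u.
Proof. exact: sqrtr_ge0. Qed.

Lemma sqr_enorm (R : realType) (n : nat) (u : 'cV[R]_n) :
  enorm u ^+ 2 = dotp u u.
Proof. by rewrite /enorm sqr_sqrtr ?dotp_ge0. Qed.

Lemma enormZ (R : realType) (n : nat) (a : R) (u : 'cV[R]_n) :
  enorm (a *: u) = `|a| * enorm u.
Proof.
by rewrite /enorm dotpZl dotpZr mulrA -expr2 sqrtrM ?sqr_ge0// sqrtr_sqr.
Qed.

Lemma cauchy_schwarz_sqr (R : realType) (n : nat) (u v : 'cV[R]_n) :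
  dotp u v ^+ 2 <= dotp u u * dotp v v.
Proof.
have [->|v0] := eqVneq v 0; first by rewrite !dotp0 expr0n mulr0.
have vv := dotp_gt0 v0.
(* Up to a scalar, this vector is the component of [u] orthogonal to [v]; its squared norm is
   [b * (a * b - c ^+ 2)]. *)
have := dotp_ge0 (dotp v v *: u + (- dotp u v) *: v).
rewrite !(dotpDl, dotpDr, dotpZl, dotpZr) (dotpC v u).
set a := dotp u u; set b := dotp v v in vv *; set c := dotp u v.
rewrite [leRHS](_ : _ = b * (a * b - c ^+ 2)); last by ring.
by rewrite pmulr_rge0// subr_ge0.
Qed.

Lemma cauchy_schwarz (R : realType) (n : nat) (u v : 'cV[R]_n) :
  `|dotp u v| <= enorm u * enorm v.
Proof.
rewrite -sqrtr_sqr /enorm -sqrtrM ?dotp_ge0// ler_wsqrtr//.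
exact: cauchy_schwarz_sqr.
Qed.

(** * Spectral norm and Rayleigh bounds *)

(** Ensures that the [sup] defining [spectral_norm] is a genuine upper bound. The witness is the
    Frobenius norm, by Cauchy-Schwarz on each row. *)
Lemma enorm_mulmx_bounded (R : realType) (m n : nat) (A : 'M[R]_(m, n)) :
  exists C : R, forall v : 'cV[R]_n, enorm v <= 1 -> enorm (A *m v) <= C.
Proof.
exists (Num.sqrt (\sum_i dotp (row i A)^T (row i A)^T)) => v v1.
rewrite /enorm ler_wsqrtr//; apply: ler_sum => i _.
have -> : (A *m v) i 0 = dotp (row i A)^T v.
  by rewrite dotpE trmxK -row_mul !mxE.
rewrite -expr2 (le_trans (cauchy_schwarz_sqr _ _))// ler_piMr ?dotp_ge0//.
by rewrite -sqr_enorm expr_le1 ?enorm_ge0.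
Qed.

Lemma enorm_mulmx_le (R : realType) (m n : nat) (A : 'M[R]_(m, n))
    (v : 'cV[R]_n) :
  enorm (A *m v) <= spectral_norm A * enorm v.
Proof.
have [->|v0] := eqVneq v 0; first by rewrite mulmx0 /enorm !dotp0 sqrtr0 mulr0.
have nv : 0 < enorm v by rewrite sqrtr_gt0 dotp_gt0.
rewrite -ler_pdivrMr//.
have -> : enorm (A *m v) / enorm v = enorm (A *m ((enorm v)^-1 *: v)).
  by rewrite -scalemxAr enormZ ger0_norm ?invr_ge0 ?enorm_ge0// mulrC.
have [C AC] := enorm_mulmx_bounded A.
apply: ub_le_sup; first by exists C => _ [w /= w1 <-]; exact: AC.
exists ((enorm v)^-1 *: v) => //=.
by rewrite enormZ ger0_norm ?invr_ge0 ?enorm_ge0// mulVf ?gt_eqF.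
Qed.

Lemma dotp_mulmx_le (R : realType) (n : nat) (A : 'M[R]_n) (v : 'cV[R]_n) :
  dotp v (A *m v) <= spectral_norm A * enorm v ^+ 2.
Proof.
rewrite (le_trans (ler_norm _))// (le_trans (cauchy_schwarz _ _))//.
by rewrite mulrC expr2 mulrA ler_wpM2r ?enorm_ge0// enorm_mulmx_le.
Qed.

(* The first-order term in [e] of the form at [u + e *: (A *m u)] must vanish. *)
Lemma psd_kernel (R : realType) (n : nat) (A : 'M[R]_n) (u : 'cV[R]_n) :
  A^T = A -> (forall v, 0 <= dotp v (A *m v)) -> dotp u (A *m u) = 0 ->
  A *m u = 0.
Proof.
move=> As A0 u0; apply/eqP; rewrite -dotp_eq0; apply/eqP.
set v := A *m u; set b := dotp v v; set c := dotp v (A *m v).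
have c0 : 0 <= c by exact: A0.
have b0 : 0 <= b by exact: dotp_ge0.
have quad e : 0 <= 2 * e * b + e ^+ 2 * c.
  have := A0 (u + e *: v).
  rewrite mulmxDr -scalemxAr !(dotpDl, dotpDr, dotpZl, dotpZr) u0.
  rewrite -/v -/b -/c (dotpC u) dotp_mulmxl As -/v -/b.
  by congr (_ <= _); ring.
have c1 : 0 < c + 1 by rewrite ltr_wpDl.
(* A negative [e] small enough for the linear term to dominate; the [+ 1] keeps the denominator
   positive when [c = 0]. *)
have := quad (- b / (c + 1)).
have -> : 2 * (- b / (c + 1)) * b + (- b / (c + 1)) ^+ 2 * c
  = - (b ^+ 2 * (c + 2)) / (c + 1) ^+ 2 by field; rewrite gt_eqF.
rewrite pmulr_lge0 ?invr_gt0 ?exprn_gt0// oppr_ge0 => h.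
apply/eqP; rewrite -sqrf_eq0; apply/eqP/le_anti; rewrite sqr_ge0 andbT.
by move: h; rewrite pmulr_lle0// ltr_wpDl.
Qed.

(** Stated on row vectors to match the extreme value theorem [EVT_min_rV]. *)
Lemma continuous_quadratic_form (R : realType) (n : nat) (A : 'M[R]_n) :
  continuous (fun r : 'rV[R]_n => dotp r^T (A *m r^T)).
Proof.
have -> : (fun r : 'rV[R]_n => dotp r^T (A *m r^T)) =
    (fun r => \sum_i r 0 i * \sum_j A i j * r 0 j).
  apply/funext => r; apply: eq_bigr => i _; rewrite !mxE; congr (_ * _).
  by apply: eq_bigr => j _; rewrite !mxE.
apply: continuous_big => [|i _ r]; first exact: add_continuous.
apply: continuousM; first exact: coord_continuous.
move: r; apply: continuous_big => [|j _ r]; first exact: add_continuous.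
by apply: continuousM; [exact: cst_continuous|exact: coord_continuous].
Qed.

(** The form attains its minimum [a] on the compact unit sphere, at some [r]. Then [A - a%:M] is
    positive semidefinite and its form vanishes at [r], so [psd_kernel] makes [r] an eigenvector.
    The nonzero [v] supplies a point of the sphere. *)
Lemma rayleigh_eigenvalue (R : realType) (n : nat) (A : 'M[R]_n)
    (v : 'cV[R]_n) : A^T = A -> v != 0 ->
  exists2 a : R, eigenvalue A a & forall w, a * dotp w w <= dotp w (A *m w).
Proof.
move=> As v0.
have vv := dotp_gt0 v0.
pose S := [set r : 'rV[R]_n | dotp r^T r^T = 1].
have S0 : S !=set0.
  exists ((enorm v)^-1 *: v)^T; rewrite /S /= trmxK dotpZl dotpZr mulrA.
  by rewrite -expr2 exprVn sqr_enorm mulVf ?gt_eqF.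
have cS : compact S.
  apply: bounded_closed_compact.
    exists 1; split => // M M1 r /= Sr; rewrite (le_trans _ (ltW M1))//.
    (* The norm here is the sup norm: the square of each entry is one term of a nonnegative sum
       equal to 1. *)
    rewrite /Num.Def.normr /= mx_normrE; apply: bigmax_le => // -[i j] _ /=.
    rewrite -(@expr_le1 _ 2)// real_normK ?num_real// -Sr.
    rewrite ord1 /dotp (bigD1 j)//= !mxE -expr2 lerDl.
    by apply: sumr_ge0 => l _; rewrite -expr2 sqr_ge0.
  have -> : S = (fun r : 'rV[R]_n => dotp r^T (1%:M *m r^T)) @^-1` [set 1].
    by apply/seteqP; split => r; rewrite /S /= mul1mx.
  apply: preimage_closed; last exact: closed_eq.
  by move=> ? _; exact: continuous_quadratic_form.
have [r] := EVT_min_rV S0 cS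
  (continuous_subspaceT (@continuous_quadratic_form _ _ A)).
rewrite inE => Sr rmin; set a := dotp r^T (A *m r^T) in rmin.
have amin w : a * dotp w w <= dotp w (A *m w).
  have [->|w0] := eqVneq w 0; first by rewrite mulmx0 !dotp0 mulr0.
  have ww := dotp_gt0 w0.
  rewrite -ler_pdivlMr// mulrC.
  have := rmin ((enorm w)^-1 *: w)^T.
  rewrite inE /S /= trmxK -scalemxAr !(dotpZl, dotpZr) mulrA.
  rewrite -expr2 exprVn sqr_enorm mulVf ?gt_eqF// mulrA -expr2 exprVn sqr_enorm.
  exact.
exists a => //; apply/eigenvalueP; exists r; last first.
  by apply: contra_eq_neq Sr => ->; rewrite trmx0 dotp0 eq_sym oner_eq0.
have quad w : dotp w ((A - a%:M) *m w) = dotp w (A *m w) - a * dotp w w.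
  by rewrite mulmxBl mul_scalar_mx -scaleNr dotpDr dotpZr mulNr.
have : (A - a%:M) *m r^T = 0.
  apply: psd_kernel => [|w|]; first by rewrite linearB /= As tr_scalar_mx.
    by rewrite quad subr_ge0.
  by rewrite quad Sr mulr1 subrr.
rewrite mulmxBl mul_scalar_mx.
(* [eigenvalue] refers to row eigenvectors, hence the transposition, undone on [A] by symmetry. *)
move=> /(congr1 trmx); rewrite linearB linearZ /= trmx_mul trmxK As trmx0.
by move/eqP; rewrite subr_eq0 => /eqP.
Qed.

Lemma lambda_min_le (R : realType) (n : nat) (A : 'M[R]_n) (v : 'cV[R]_n) :
  A^T = A -> lambda_min A * enorm v ^+ 2 <= dotp v (A *m v).
Proof.
move=> As; have [->|v0] := eqVneq v 0.
  by rewrite mulmx0 sqr_enorm !dotp0 mulr0.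
have [a ea amin] := rayleigh_eigenvalue As v0.
rewrite sqr_enorm (le_trans _ (amin v))// ler_wpM2r ?dotp_ge0//.
(* The set of eigenvalues must be bounded below for [inf] to lie below its members; [a] itself is a
   lower bound, by testing [amin] on an eigenvector. *)
apply: ge_inf => //; exists a => b /= /eigenvalueP[r rb r0].
have rr : r^T != 0 by rewrite trmx_eq0.
rewrite -(ler_pM2r (dotp_gt0 rr)) (le_trans (amin _))//.
by rewrite -[X in X *m _]As -trmx_mul rb linearZ /= dotpZr.
Qed.

(** * Derivatives along lines and Clairaut's theorem *)

(** Identifying the difference quotients themselves transfers derivability and the value of the
    derivative at once, with no chain rule. *)
Lemma line_growth (R : realType) (V : normedModType R) (W : normedModType R)
    (f : V -> W) (x v : V) (s : R) :
  (fun h : R => h^-1 *: (((fun r : R => f (x + r *: v)) \o shift s) (h *: 1)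
                         - f (x + s *: v)))
  = (fun h : R => h^-1 *: ((f \o shift (x + s *: v)) (h *: v)
                           - f (x + s *: v))).
Proof.
apply/funext => h /=; congr (_ *: (f _ - _)).
by rewrite [h *: 1]mulr1 scalerDl addrCA.
Qed.

Lemma is_derive_line (R : realType) (V W : normedModType R) (f : V -> W)
    (x v : V) (s : R) :
  derivable f (x + s *: v) v ->
  is_derive s (1 : R) (fun r : R => f (x + r *: v)) ('D_v f (x + s *: v)).
Proof.
by move=> df; apply: DeriveDef; rewrite /derivable /derive line_growth.
Qed.

Lemma MVT_line (R : realType) (V : normedModType R) (f : V -> R) (x v : V)
    (h : R) :
  0 < h -> (forall y, derivable f y v) ->
  exists2 c, 0 < c < h & f (x + h *: v) - f x = h * 'D_v f (x + c *: v).
Proof.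
move=> h0 df.
have dg (s : R) : is_derive s (1 : R) (fun r : R => f (x + r *: v))
    ('D_v f (x + s *: v)).
  exact: is_derive_line.
have [|c cI] := @MVT R _ _ _ _ h0 (fun s _ => dg s).
  apply: derivable_within_continuous => s _.
  exact: (@ex_derive _ _ _ _ _ _ _ (dg s)).
rewrite scale0r addr0 subr0 mulrC => E.
by exists c => //; move: cI; rewrite in_itv.
Qed.

(** Two mean value steps: first for [f (y + h *: w) - f y] along [v], then for ['D_v f] along
    [w]. *)
Lemma second_difference (R : realType) (V : normedModType R) (f : V -> R)
    (x v w : V) (h : R) :
  0 < h -> (forall y, derivable f y v) ->
  (forall y, derivable ('D_v f) y w) ->
  exists c e, [/\ 0 < c < h, 0 < e < h &
    f (x + h *: v + h *: w) - f (x + h *: v) - f (x + h *: w) + f x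
    = h ^+ 2 * 'D_w ('D_v f) (x + c *: v + e *: w)].
Proof.
move=> h0 df ddf.
pose g (y : V) := f (y + h *: w) - f y.
have dsh y : is_derive y v (fun z => f (z + h *: w)) ('D_v f (y + h *: w)).
  have E : (fun r : R =>
        r^-1 *: (((fun z => f (z + h *: w)) \o shift y) (r *: v)
              - f (y + h *: w)))
    = (fun r : R => r^-1 *: ((f \o shift (y + h *: w)) (r *: v)
              - f (y + h *: w))).
    by apply/funext => r /=; rewrite addrA.
  by apply: DeriveDef; rewrite /derivable /derive E//; exact: df.
have dg y : is_derive y v g ('D_v f (y + h *: w) - 'D_v f y).
  by apply: is_deriveB; exact: derivableP.
have [|c c0 Ec] := @MVT_line _ _ g x v h h0.
  by move=> y; exact: (@ex_derive _ _ _ _ _ _ _ (dg y)).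
have [e e0 Ee] := MVT_line (x + c *: v) h0 ddf.
exists c, e; split => //.
rewrite expr2 -mulrA -Ee -(@derive_val _ _ _ _ _ _ _ (dg _)) -Ec /g.
by ring.
Qed.

Lemma ler_dist_half_add (R : realFieldType) (e a1 a2 z1 z2 : R) :
  `|a1 - z1| <= e / 2 -> `|a2 - z2| <= e / 2 -> z1 = z2 -> `|a1 - a2| <= e.
Proof.
move=> h1 h2 z12; rewrite (splitr e) (le_trans (ler_distD z1 _ _))// lerD//.
by rewrite z12 distrC.
Qed.

(* Clairaut: both mixed derivatives are limits of the same symmetric second
   difference. *)
Lemma derive_comm (R : realType) (V : normedModType R) (f : V -> R)
    (x v w : V) :
  (forall y, derivable f y v) -> (forall y, derivable f y w) ->
  (forall y, derivable ('D_v f) y w) -> (forall y, derivable ('D_w f) y v) ->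
  {for x, continuous ('D_w ('D_v f))} -> {for x, continuous ('D_v ('D_w f))} ->
  'D_w ('D_v f) x = 'D_v ('D_w f) x.
Proof.
move=> dv dw dvw dwv cvw cwv; apply/eqP; rewrite -subr_eq0 -normr_le0.
apply/ler_addgt0Pl => e e0; rewrite addr0.
have e20 : 0 < e / 2 by rewrite divr_gt0.
move/cvgrPdist_le : cvw => /(_ _ e20) /nbhs_ballP[d1 /= d10 H1].
move/cvgrPdist_le : cwv => /(_ _ e20) /nbhs_ballP[d2 /= d20 H2].
set d := Num.min d1 d2.
have d0 : 0 < d by rewrite lt_min d10.
have dd1 : d <= d1 by rewrite ge_min lexx.
have dd2 : d <= d2 by rewrite ge_min lexx orbT.
(* With [h = d / b], every displacement of size below [h] along both [v] and [w] stays within [d] of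
   [x]; the [+ 1] makes [b] positive and the bound strict. *)
set b := `|v| + `|w| + 1.
have b0 : 0 < b by rewrite ltr_wpDl// addr_ge0.
pose h := d / b.
have h0 : 0 < h by rewrite divr_gt0.
have nearx (p q : R) (a c : V) : 0 < p < h -> 0 < q < h ->
    `|a| + `|c| < b -> ball x d (x + p *: a + q *: c).
  move=> /andP[p0 ph] /andP[q0 qh] ac.
  rewrite -ball_normE /ball_ /= -addrA opprD addrA subrr add0r normrN.
  rewrite (le_lt_trans (ler_normD _ _))// !normrZ !gtr0_norm//.
  rewrite (@le_lt_trans _ _ (h * (`|a| + `|c|)))//.
    by rewrite mulrDr lerD// ler_wpM2r// ltW.
  by rewrite mulrC -ltr_pdivlMr// /h invf_div mulrCA divff ?mulr1// gt_eqF.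
have [p [q [p0 q0 Epq]]] := second_difference x h0 dv dvw.
have [p' [q' [p'0 q'0 Epq']]] := second_difference x h0 dw dwv.
have E : 'D_w ('D_v f) (x + p *: v + q *: w)
       = 'D_v ('D_w f) (x + p' *: w + q' *: v).
  apply: (@mulfI _ (h ^+ 2)); first by rewrite expf_neq0// gt_eqF.
  apply: etrans (esym Epq) (etrans _ Epq').
  by rewrite [x + h *: w + h *: v]addrAC; congr (_ + _); exact: addrAC.
have vwb : `|v| + `|w| < b by rewrite ltrDl.
have wvb : `|w| + `|v| < b by rewrite addrC.
exact: ler_dist_half_add (H1 _ (le_ball dd1 (nearx _ _ _ _ p0 q0 vwb)))
  (H2 _ (le_ball dd2 (nearx _ _ _ _ p'0 q'0 wvb))) E.
Qed.

(** * Gradient and Hessian as directional derivatives *)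

Lemma derive_dotp_gradient (R : realType) (n : nat) (f : 'cV[R]_n -> R)
    (x v : 'cV[R]_n) :
  differentiable f x -> 'D_v f x = dotp (gradient f x) v.
Proof.
move=> fx; rewrite deriveE// [v in LHS]matrix_sum_delta linear_sum.
apply: eq_bigr => j _; rewrite big_ord1 linearZ /= mxE deriveE//.
by rewrite mulrC.
Qed.

Lemma differentiable_partial (R : realType) (n : nat) (f : 'cV[R]_n -> R)
    (k : 'I_n) (x : 'cV[R]_n) :
  differentiable (gradient f) x -> differentiable ('D_(delta_mx k 0) f) x.
Proof.
move=> dgf.
have -> : 'D_(delta_mx k 0) f = (fun M : 'cV[R]_n => M k 0) \o gradient f.
  by apply/funext => y /=; rewrite mxE.
by apply: differentiable_comp => //; exact: differentiable_coord.
Qed.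

Lemma hessian_symmetric (R : realType) (n : nat) (f : 'cV[R]_n -> R)
    (x : 'cV[R]_n) :
  twice_continuously_differentiable f -> (hessian f x)^T = hessian f x.
Proof.
move=> [df dgf chf]; apply/matrixP => j k; rewrite !mxE.
have cD i l : {for x, continuous
    ('D_(delta_mx i 0 : 'cV[R]_n) ('D_(delta_mx l 0 : 'cV[R]_n) f))}.
  have -> : 'D_(delta_mx i 0 : 'cV[R]_n) ('D_(delta_mx l 0 : 'cV[R]_n) f)
      = (fun M : 'M[R]_n => M i l) \o hessian f.
    by apply/funext => y /=; rewrite mxE.
  by apply: continuous_comp; [exact: chf|exact: coord_continuous].
apply: derive_comm => //.
- by move=> y; exact: diff_derivable.
- by move=> y; exact: diff_derivable.
- by move=> y; apply/diff_derivable/differentiable_partial.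
- by move=> y; apply/diff_derivable/differentiable_partial.
Qed.

(** ['D_v f] is a combination of partial derivatives with constant coefficients [v k 0], and each
    partial is differentiable because the gradient is. *)
Lemma is_derive2_hessian (R : realType) (n : nat) (f : 'cV[R]_n -> R)
    (x v : 'cV[R]_n) :
  twice_continuously_differentiable f ->
  is_derive x v ('D_v f) (dotp v (hessian f x *m v)).
Proof.
move=> [df dgf _].
have -> : 'D_v f = \sum_(k < n) (v k 0 *: ('D_(delta_mx k 0 : 'cV[R]_n) f)).
  apply/funext => y; rewrite derive_dotp_gradient// fct_sumE.
  by apply: eq_bigr => k _; rewrite mxE mulrC.
have -> : dotp v (hessian f x *m v)
    = \sum_k v k 0 *: 'D_v ('D_(delta_mx k 0 : 'cV[R]_n) f) x.
  rewrite /dotp.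
  under eq_bigr do rewrite mxE mulr_sumr.
  rewrite exchange_big /=; apply: eq_bigr => k _.
  rewrite derive_dotp_gradient; last exact: differentiable_partial.
  rewrite /dotp scaler_sumr; apply: eq_bigr => j _.
  by rewrite !mxE mulrC mulrAC; exact: mulrC.
apply: is_derive_sum => k; apply: is_deriveZ; apply: derivableP.
exact/diff_derivable/differentiable_partial.
Qed.

(** * Second-order Taylor inequality in one variable *)

(** Mean value theorem for [g - h]; it serves to integrate an inequality between derivatives. *)
Lemma ler_is_derive (R : realType) (g h dg dh : R -> R) :
  (forall s : R, is_derive s (1 : R) g (dg s)) ->
  (forall s : R, is_derive s (1 : R) h (dh s)) ->
  (forall s, 0 <= s <= 1 -> dg s <= dh s) ->
  forall s, 0 <= s <= 1 -> g s - g 0 <= h s - h 0.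
Proof.
move=> dgE dhE le_d s /andP[s0 s1].
have dk (r : R) : is_derive r (1 : R) (g - h) (dg r - dh r).
  exact: is_deriveB.
have [|c] := @MVT_segment R _ _ _ _ s0 (fun r _ => dk r).
  apply: derivable_within_continuous => r _.
  exact: (@ex_derive _ _ _ _ _ _ _ (dk r)).
rewrite in_itv /= => /andP[c0 cs] E.
rewrite -subr_le0.
have -> : g s - g 0 - (h s - h 0) = (g s - h s) - (g 0 - h 0).
  by ring.
rewrite [leLHS]E subr0 mulr_le0_ge0// subr_le0 le_d// c0 /=.
exact: le_trans s1.
Qed.

Lemma taylor2_le (R : realType) (g dg ddg : R -> R) (C : R) :
  (forall s : R, is_derive s (1 : R) g (dg s)) ->
  (forall s : R, is_derive s (1 : R) dg (ddg s)) ->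
  (forall s, 0 <= s <= 1 -> ddg s - ddg 0 <= C * s) ->
  g 1 <= g 0 + dg 0 + 2^-1 * ddg 0 + C / 6.
Proof.
move=> gE dgE le_C.
(* [q] and [p] are the first and second antiderivatives of the bound [ddg 0 + C * s], with [dg 0]
   added before the second integration. *)
pose q : {poly R} := ddg 0 *: 'X + (C / 2) *: 'X^2.
pose p : {poly R} := dg 0 *: 'X + (ddg 0 / 2) *: 'X^2 + (C / 6) *: 'X^3.
have le_q s : 0 <= s <= 1 -> dg s - dg 0 <= q.[s] - q.[0].
  apply: (ler_is_derive dgE (fun s => is_derive_poly q s)) => r r01.
  have -> : q^`().[r] = ddg 0 + C * r.
    by rewrite /q !poly.derivE !hornerE; field.
  by rewrite -lerBlDl le_C.
have : g 1 - g 0 <= p.[1] - p.[0].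
  apply: (ler_is_derive gE (fun s => is_derive_poly p s)); last first.
    by rewrite ler01 lexx.
  move=> r r01.
  have -> : p^`().[r] = dg 0 + (q.[r] - q.[0]).
    by rewrite /p /q !poly.derivE !hornerE /=; field.
  by rewrite -lerBlDl le_q.
rewrite /p !hornerE /=; lra.
Qed.

(** * Block derivatives and the cubic upper bound *)

Lemma dotp_block_gradient (R : realType) (N : nat) (f : 'cV[R]_N -> R)
    (S : {set 'I_N}) (x : 'cV[R]_N) (t : 'cV[R]_#|S|) :
  dotp (block_gradient f S x) t = dotp (gradient f x) (blockU S *m t).
Proof. by rewrite dotp_mulmxl trmxK. Qed.

Lemma dotp_block_hessian (R : realType) (N : nat) (f : 'cV[R]_N -> R)
    (S : {set 'I_N}) (x : 'cV[R]_N) (t : 'cV[R]_#|S|) :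
  dotp t (block_hessian f S x *m t)
  = dotp (blockU S *m t) (hessian f x *m (blockU S *m t)).
Proof. by rewrite dotp_mulmxl /block_hessian !mulmxA. Qed.

Lemma block_hessian_symmetric (R : realType) (N : nat) (f : 'cV[R]_N -> R)
    (S : {set 'I_N}) (x : 'cV[R]_N) :
  twice_continuously_differentiable f ->
  (block_hessian f S x)^T = block_hessian f S x.
Proof.
by move=> f2; rewrite !trmx_mul trmxK hessian_symmetric// mulmxA.
Qed.

(** Along the segment from [x] to [x + blockU S *m t], the second derivative at [s] exceeds its
    value at 0 by at most [M * enorm t ^+ 3 * s]: one factor [enorm t] comes from the Lipschitz
    bound, two from the quadratic form. *)
Lemma block_cubic_upper_bound (R : realType) (N : nat) (f : 'cV[R]_N -> R)
    (S : {set 'I_N}) (M : R) (x : 'cV[R]_N) (t : 'cV[R]_#|S|) :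
  twice_continuously_differentiable f ->
  (forall u : 'cV[R]_#|S|,
     spectral_norm (block_hessian f S (x + blockU S *m u)
                    - block_hessian f S x) <= M * enorm u) ->
  f (x + blockU S *m t) <= f x + dotp (block_gradient f S x) t
    + 2^-1 * dotp t (block_hessian f S x *m t) + M * enorm t ^+ 3 / 6.
Proof.
move=> f2 lipH; have [df _ _] := f2.
set d := blockU S *m t.
have gE (s : R) : is_derive s (1 : R) (fun r : R => f (x + r *: d))
    ('D_d f (x + s *: d)).
  by apply: is_derive_line; exact: diff_derivable.
have dgE (s : R) : is_derive s (1 : R) (fun r : R => 'D_d f (x + r *: d))
    (dotp t (block_hessian f S (x + s *: d) *m t)).
  have dd := is_derive2_hessian (x + s *: d) d f2.
  rewrite dotp_block_hessian -/d -(@derive_val _ _ _ _ _ _ _ dd).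
  by apply: is_derive_line; exact: (@ex_derive _ _ _ _ _ _ _ dd).
have := @taylor2_le _ _ _ _ (M * enorm t ^+ 3) gE dgE.
rewrite scale1r scale0r addr0 derive_dotp_gradient// -dotp_block_gradient.
apply=> s /andP[s0 _].
(* The two forms merge into the form of the difference of block Hessians; the Lipschitz bound is
   then used at [s *: t]. *)
rewrite -[X in _ - X]mul1r -mulNr -dotpZr scaleN1r -dotpDr -mulmxBl.
rewrite (le_trans (dotp_mulmx_le _ _))// scalemxAr.
rewrite (le_trans (ler_wpM2r _ (lipH _)))// ?exprn_ge0 ?enorm_ge0//.
by rewrite enormZ ger0_norm// [leLHS](_ : _ = M * enorm t ^+ 3 * s); last ring.
Qed.

(** * Finite iterates and acceptance of the unit step *)

(** The start is finite by assumption, and every accepted step carries finiteness in its first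
    clause. *)
Lemma RCD_iterate_finite (R : realType) (N : nat) (I : finType)
    (f : 'cV[R]_N -> R) (Psi : 'cV[R]_N -> \bar R) (B : I -> {set 'I_N})
    (psi : forall i : I, 'cV[R]_#|B i| -> \bar R) (p : I -> R)
    (beta theta xi : R) (eta : nat -> I -> R) (k : nat) (x : 'cV[R]_N) :
  RCD_iterate f Psi psi p beta theta xi eta k x -> (Psi x < +oo)%E.
Proof.
move=> it; suff : (objective f Psi x < +oo)%E.
  by rewrite /objective; case: (Psi x) => [r _|//|_]; rewrite ?ltry ?ltNyr.
elim: it => // {}k {}x i t a _ _ _ _ _ [trial [j [_ _ -> [fin _] _]]].
exact: fin.
Qed.

(* Here [D] is the decrease of the linearized loss, [D - q / 2] that of the
   quadratic model, and [m n^3 / 6] bounds the error of the model. *)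
Lemma unit_step_decrease (R : realFieldType) (theta xi m n l q D : R) :
  0 < theta -> theta < xi -> xi < 1 -> 0 <= n -> 0 <= l ->
  n * m <= 3 * l * (xi - theta) -> l * n ^+ 2 <= q ->
  xi * D <= D - q / 2 -> theta * D <= D - q / 2 - m * n ^+ 3 / 6.
Proof.
move=> theta0 theta_xi xi1 n0 l0 n_small l_le decr.
have gap0 : 0 < xi - theta by rewrite subr_gt0.
have q0 : 0 <= q by rewrite (le_trans _ l_le)// mulr_ge0// sqr_ge0.
have D0 : 0 <= D.
  have : 0 <= (1 - xi) * D by rewrite mulrBl mul1r; lra.
  by rewrite pmulr_rge0// subr_gt0.
have xiD0 : 0 <= xi * D by rewrite mulr_ge0// ltW// (lt_trans theta0).
(* [D] is at least [q / 2], since [xi * D] is nonnegative, and [q / 2] is at least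
   [l * n ^+ 2 / 2]. *)
have gap_q : (xi - theta) * (l * n ^+ 2 / 2) <= (xi - theta) * D.
  by apply: ler_wpM2l; [exact: ltW|lra].
(* Multiplying the step bound by [n ^+ 2] turns it into a bound on the cubic error, at most
   [(xi - theta) * (l * n ^+ 2 / 2)]. *)
have := ler_wpM2r (sqr_ge0 n) n_small.
have -> : n * m * n ^+ 2 = m * n ^+ 3 by ring.
lra.
Qed.

Unset Implicit Arguments.

Theorem theorem5p5 (R : realType) (N : nat)
  (f : 'cV[R]_N -> R) (Psi : 'cV[R]_N -> \bar R)
  (I : finType) (B : I -> {set 'I_N})
  (psi : forall i : I, 'cV[R]_#|B i| -> \bar R)
  (p : I -> R) (M : I -> R) (mu_f beta theta xi : R) (eta : nat -> I -> R)
  (Psi_proper : proper_efun Psi)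
  (Psi_lsc : lower_semicontinuous Psi)
  (Psi_convex : econvex Psi)
  (B_nonempty : forall i, B i != finset.set0)
  (B_cover : forall j : 'I_N, exists i, j \in B i)
  (Psi_separable : forall i, block_separable Psi (psi i))
  (f_C2 : twice_continuously_differentiable f)
  (mu_f_gt0 : 0 < mu_f)
  (f_strongly_convex : strongly_convex f mu_f)
  (M_gt0 : forall i, 0 < M i)
  (hessian_lipschitz : forall (i : I) (x : 'cV[R]_N) (t : 'cV[R]_#|B i|),
     spectral_norm (block_hessian f (B i) (x + blockU (B i) *m t)
                    - block_hessian f (B i) x) <= M i * enorm t)
  (p_gt0 : forall i, 0 < p i)
  (p_sum1 : \sum_i p i = 1)
  (beta_gt0 : 0 < beta)
  (theta_range : 0 < theta < 1 / 2)
  (xi_range : theta < xi < 1 / 2)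
  (eta_range : forall k i, 0 <= eta k i < 1)
  (k : nat) (x_k : 'cV[R]_N) (i : I) (t_k : 'cV[R]_#|B i|)
  (x_k_iterate : RCD_iterate f Psi psi p beta theta xi eta k x_k)
  (x_k_nonstationary : residual f (psi i) beta x_k 0 <> 0)
  (t_k_stopping : stopping f Psi (psi i) beta xi (eta k i) x_k t_k)
  (t_k_small : enorm t_k
     <= 3 * lambda_min (block_hessian f (B i) x_k) * (xi - theta) / M i) :
  accepts f Psi theta x_k (blockU (B i) *m t_k) 1.
Proof.
have [psiN _] := Psi_proper.
have xfin := RCD_iterate_finite x_k_iterate.
have [] := t_k_stopping; rewrite /accepts /model /loss /objective.
rewrite scale1r mulmx0 addr0 !dotp0 addr0.
(* Both values of [Psi] are finite: properness excludes [-oo], while the iterate and the stopping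
   rule exclude [+oo]. The inequalities become real ones. *)
move: (psiN x_k) (psiN (x_k + blockU (B i) *m t_k)) xfin.
case: (Psi x_k) => [r| |] // _.
case: (Psi (x_k + _)) => [r'| |] // _ _ _ + _.
rewrite /anorm mulmx0 dotp0 sqrtr0 expr0n mulr0 addr0.
rewrite -!(EFinD, EFinN, EFinB, EFinM) !lee_fin ltry => decr.
split => //; move: decr.
have cubic := block_cubic_upper_bound t_k f_C2 (hessian_lipschitz i x_k).
have q_ge := lambda_min_le t_k (block_hessian_symmetric (B i) x_k f_C2).
have small : enorm t_k * M i
    <= 3 * lambda_min (block_hessian f (B i) x_k) * (xi - theta).
  by rewrite -ler_pdivlMr.
have gap : 0 < 3 * (xi - theta).
  by rewrite mulr_gt0// subr_gt0; case/andP: xi_range.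
(* The sign is read off [small]: its left side is nonnegative and the factor [3 * (xi - theta)] is
   positive. *)
have l_ge0 : 0 <= lambda_min (block_hessian f (B i) x_k).
  rewrite -(@pmulr_lge0 _ (3 * (xi - theta)))// mulrCA mulrA.
  by rewrite (le_trans _ small)// mulr_ge0 ?enorm_ge0// ltW.
(* [anorm] is a square root, so squaring it recovers the form once the form is known to be
   nonnegative. *)
rewrite sqr_sqrtr; last by rewrite (le_trans _ q_ge)// mulr_ge0// sqr_ge0.
rewrite -dotp_block_gradient => decr.
have [theta0 _] := andP theta_range; have [theta_xi xi_lt] := andP xi_range.
set D := (X in theta * X).
have : theta * D <= D - dotp t_k (block_hessian f (B i) x_k *m t_k) / 2
    - M i * enorm t_k ^+ 3 / 6.
  apply: unit_step_decrease theta0 theta_xi _ (enorm_ge0 t_k) l_ge0 small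
    q_ge _.
    by lra.
  by apply: (le_trans decr); rewrite /D; lra.
(* By [cubic], the true decrease is at least the model decrease minus the cubic error. *)
by move/le_trans; apply; rewrite /D; lra.
Qed.
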